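(* Let $x_n(s):\Sigma\times I\to\mathbb{R}^2\cong\mathbb{C}$ be an isoperimetric mKdV motion of a discrete curve $x^0_n=x_n(s_0)$ for some $s_0\in I$. Give $x^0$ the arc-length polarization, i.e. $\mu_{(n,n+1)}=\frac{1}{a_n^2}$ on every edge $(n,n+1)$, where $a_n=|x^0_{n+1}-x^0_n|$. Then $x_n(s)$ is an infinitesimal Darboux transformation (with some parameter function $m:I\to\mathbb{R}^\times$) of the discrete polarized curve $x^0:(\Sigma,\frac1\mu)\to\mathbb{C}$ which keeps the arc-length polarization, i.e. $\mu$ is the discrete arc-length polarization of $x(s)$ for every $s\in I$.
   Context: Identify $\mathbb{R}^2\cong\mathbb{C}$; $'$ denotes $\frac{d}{ds}$; $I\subset\mathbb{R}$ is an interval; $\Sigma\subset\mathbb{Z}$ is a discrete interval (a set of consecutive integers), with edges $(n,n+1)$, $n,n+1\in\Sigma$. A discrete curve $n\mapsto x_n\in\mathbb{R}^2$ is regular if $\det(x_n-x_{n-1}\;\;x_{n+1}-x_n)\ne0$ on any three consecutive vertices. Isoperimetric mKdV motion (the continuous motion resulting in the semi-discrete potential mKdV equation): a map $x:\Sigma\times I\to\mathbb{C}$, smooth in $s$, with $x_n\neq x_{n+1}$ on every edge, with every discrete curve $x(s)$ regular, with $|x_n'|\equiv1$ for all $(n,s)$, and satisfying the following isoperimetric condition. Put $a_n=|x_{n+1}-x_n|$ and $T_n=(x_{n+1}-x_n)/a_n=e^{i\psi_n}$. Let $w_n$ be the angle from $T_n$ to $x_n'$, i.e. $x_n'=e^{iw_n}T_n$,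 and let $\kappa_{n+1}$ be the angle from $T_n$ to $T_{n+1}$ ($\psi_{n+1}=\psi_n+\kappa_{n+1}$), so that $w_{n+1}+\kappa_{n+1}$ is the angle from $T_n$ to $x_{n+1}'$. The condition, on every edge, is $w_{n+1}+\kappa_{n+1}=-w_n$ (modulo $2\pi$), i.e. $x_{n+1}'=e^{-iw_n}T_n$ (in this last form it also makes sense when $n+1$ is the last vertex). It is the condition for the motion to be isoperimetric ($a_n'\equiv0$), the trivial solution $w_{n+1}+\kappa_{n+1}=w_n$ being excluded. A discrete polarized curve $x^0:(\Sigma,\frac1\mu)\to\mathbb{C}$ is a discrete curve together with a strictly positive or strictly negative function $\mu$ on the unoriented edges of $\Sigma$. The function $\mu$ is the discrete arc-length polarization of a discrete curve $x$ if $\frac1{\mu_{(n,n+1)}}=|x_n-x_{n+1}|^2$ on every edge. For $m:I\to\mathbb{R}^\times$, an infinitesimal Darboux transformation of $x^0$ with parameter function $m$ is a map $x:\Sigma\times I\to\mathbb{C}$, smooth in $s$, with $x_n(s_0)=x_n^0$ for all $n\in\Sigma$, for some $s_0\in I$, and such that on every edge $\frac{x_n'x_{n+1}'}{(x_n-x_{n+1})^2}=\frac{\mu_{(n,n+1)}}{m}$ for all $s\in I$. *)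

(* Defs.v *)
From Stdlib Require Import Reals ZArith Lra.
From Coquelicot Require Import Coquelicot.

Open Scope R_scope.

(** * Intervals *)

Definition is_discrete_interval (Sigma : Z -> Prop) : Prop :=
  forall a b c : Z, Sigma a -> Sigma c -> (a <= b <= c)%Z -> Sigma b.

(** An edge [(n, n+1)] is encoded by its left end [n]; a function on the
    unoriented edges is thus a function [Z -> R] of which only the values at
    the [n] with [is_edge Sigma n] matter. *)
Definition is_edge (Sigma : Z -> Prop) (n : Z) : Prop :=
  Sigma n /\ Sigma (n + 1)%Z.

(** Open, closed or half-open, bounded or not.  A single point is excluded, so
    that derivatives relative to the interval are unique. *)
Definition is_interval (I : R -> Prop) : Prop :=
  (forall a b c : R, I a -> I c -> a <= b <= c -> I b) /\
  (exists a b : R, I a /\ I b /\ a < b).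

(** * Derivatives of complex-valued functions on an interval *)

(** Coquelicot's [is_derive] with [locally s] restricted to [I]: at an end of
    [I] which belongs to [I], this is the one-sided derivative. *)
Definition is_deriv_on (I : R -> Prop) (f : R -> C) (s : R) (l : C) : Prop :=
  filterdiff (U := R_NormedModule) (V := C_R_NormedModule)
    f (within I (locally s)) (fun h => scal h l).

Definition ex_deriv_on (I : R -> Prop) (f : R -> C) (s : R) : Prop :=
  exists l : C, is_deriv_on I f s l.

Definition deriv_on (I : R -> Prop) (f : R -> C) (s : R) : C :=
  iota (T := C_R_CompleteNormedModule) (is_deriv_on I f s).

Definition smooth_on (I : R -> Prop) (f : R -> C) : Prop :=
  forall (k : nat) (s : R), I s -> ex_deriv_on I (Nat.iter k (deriv_on I) f) s.

Lemma interval_nearby_point (I : R -> Prop) (s d : R) :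
  is_interval I -> I s -> 0 < d -> exists y, I y /\ y <> s /\ Rabs (y - s) < d.
Proof.
  intros [Hc (a & b & Ia & Ib & Hab)] Is Hd.
  destruct (Rle_dec b s) as [Hbs | Hbs].
  - exists (Rmax a (s - d / 2)).
    assert (H1 := Rmax_l a (s - d / 2)). assert (H2 := Rmax_r a (s - d / 2)).
    assert (H3 : Rmax a (s - d / 2) < s) by (apply Rmax_lub_lt; lra).
    split; [apply (Hc a _ s); auto; lra | split; [lra | apply Rabs_def1; lra]].
  - exists (Rmin b (s + d / 2)).
    assert (H1 := Rmin_l b (s + d / 2)). assert (H2 := Rmin_r b (s + d / 2)).
    assert (H3 : s < Rmin b (s + d / 2)) by (apply Rmin_glb_lt; lra).
    split; [apply (Hc s _ b); auto; lra | split; [lra | apply Rabs_def1; lra]].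
Qed.

Lemma is_deriv_on_unique (I : R -> Prop) (f : R -> C) (s : R) (l1 l2 : C) :
  is_interval I -> I s -> is_deriv_on I f s l1 -> is_deriv_on I f s l2 ->
  l1 = l2.
Proof.
  intros HI Is [_ H1] [_ H2].
  assert (Hl : is_filter_lim (T := R_NormedModule) (within I (locally s)) s)
    by (intros P HP; apply filter_le_within; exact HP).
  specialize (H1 s Hl). specialize (H2 s Hl).
  destruct (Req_dec (Cmod (l1 - l2)) 0) as [H0 | H0].
  { apply Cmod_eq_0 in H0. replace l1 with (l1 - l2 + l2)%C by ring.
    rewrite H0. ring. }
  exfalso.
  assert (Hp : 0 < Cmod (l1 - l2)) by (assert (H := Cmod_ge_0 (l1 - l2)); lra).
  assert (He : 0 < Cmod (l1 - l2) / 4) by lra.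
  specialize (H1 (mkposreal _ He)). specialize (H2 (mkposreal _ He)).
  destruct (filter_and _ _ H1 H2) as [d Hd].
  destruct (interval_nearby_point I s d HI Is (cond_pos d)) as (y & Iy & Hy & Hyd).
  destruct (Hd y Hyd Iy) as [K1 K2]. simpl in K1, K2.
  rewrite <- !Cmod_norm in K1, K2.
  change (norm (minus y s)) with (Rabs (y - s)) in K1, K2.
  assert (Hpos : 0 < Rabs (y - s)) by (apply Rabs_pos_lt; lra).
  assert (Hs : forall l : C,
    @scal R_AbsRing C_R_NormedModule (minus y s) l = (RtoC (y - s) * l)%C)
    by (intros [u v]; apply injective_projections; cbn; ring).
  rewrite !Hs in K1, K2.
  set (A := minus (minus (f y) (f s)) (RtoC (y - s) * l1)%C) in K1.
  set (B := minus (minus (f y) (f s)) (RtoC (y - s) * l2)%C) in K2.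
  assert (E : (RtoC (y - s) * (l1 - l2))%C = ((B : C) + - (A : C))%C).
  { apply injective_projections; cbn; ring. }
  assert (T := Cmod_triangle B (- A)%C). rewrite Cmod_opp, <- E, Cmod_mult, Cmod_R in T.
  assert (T' := Rle_trans _ _ _ T (Rplus_le_compat _ _ _ _ K2 K1)).
  assert (P := Rmult_lt_0_compat _ _ Hpos Hp). lra.
Qed.

Lemma deriv_on_correct (I : R -> Prop) (f : R -> C) (s : R) :
  is_interval I -> I s -> ex_deriv_on I f s -> is_deriv_on I f s (deriv_on I f s).
Proof.
  intros HI Is [l Hl].
  apply (iota_correct (V := C_R_CompleteNormedModule) (is_deriv_on I f s)).
  exists l. split; [exact Hl |].
  intros l' Hl'. exact (is_deriv_on_unique I f s l l' HI Is Hl Hl').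
Qed.

(** * Angles *)

Definition Cexpi (t : R) : C := (cos t, sin t).

(** [t] is a value, modulo [2 * PI], of the oriented angle from [u] to [v],
    where [Cmod u = Cmod v]. *)
Definition is_angle (u v : C) (t : R) : Prop := v = (Cexpi t * u)%C.

Lemma is_angle_add (u v w : C) (a b : R) :
  is_angle u v a -> is_angle v w b -> is_angle u w (b + a).
Proof.
  unfold is_angle, Cexpi. intros -> ->. rewrite cos_plus, sin_plus.
  apply injective_projections; simpl; ring.
Qed.

(** * Discrete curves *)

Definition det2 (u v : C) : R := Re u * Im v - Im u * Re v.

Definition regular_curve (Sigma : Z -> Prop) (x : Z -> C) : Prop :=
  forall n : Z, Sigma (n - 1)%Z -> Sigma n -> Sigma (n + 1)%Z ->
    det2 (x n - x (n - 1)%Z)%C (x (n + 1)%Z - x n)%C <> 0.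

Definition edge_length (x : Z -> C) (n : Z) : R := Cmod (x (n + 1)%Z - x n)%C.

Definition edge_tangent (x : Z -> C) (n : Z) : C :=
  ((x (n + 1)%Z - x n) / RtoC (edge_length x n))%C.

(** * Isoperimetric mKdV motions *)

(** In the last field, [w] is the angle [w_n] from [T_n] to [x_n']; by
    [is_angle_add], [w_(n+1) + kappa_(n+1)] is the angle from [T_n] to
    [x_(n+1)'], which has to be [- w_n] modulo [2 * PI]. *)
Record is_mKdV_motion (Sigma : Z -> Prop) (I : R -> Prop) (x : Z -> R -> C) :
    Prop := {
  mKdV_smooth : forall n, Sigma n -> smooth_on I (x n);
  mKdV_immersed : forall n s, is_edge Sigma n -> I s -> x n s <> x (n + 1)%Z s;
  mKdV_regular : forall s, I s -> regular_curve Sigma (fun n => x n s);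
  mKdV_unit_speed : forall n s, Sigma n -> I s -> Cmod (deriv_on I (x n) s) = 1;
  mKdV_isoperimetric : forall n s, is_edge Sigma n -> I s ->
    exists w : R,
      is_angle (edge_tangent (fun k => x k s) n) (deriv_on I (x n) s) w /\
      is_angle (edge_tangent (fun k => x k s) n) (deriv_on I (x (n + 1)%Z) s) (- w)
}.

(** * Polarizations and infinitesimal Darboux transformations *)

Definition is_polarization (Sigma : Z -> Prop) (mu : Z -> R) : Prop :=
  (forall n, is_edge Sigma n -> 0 < mu n) \/
  (forall n, is_edge Sigma n -> mu n < 0).

Definition is_arclength_polarization (Sigma : Z -> Prop) (mu : Z -> R)
    (x : Z -> C) : Prop :=
  is_polarization Sigma mu /\
  forall n, is_edge Sigma n -> / mu n = Cmod (x n - x (n + 1)%Z)%C ^ 2.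

Record is_infinitesimal_Darboux (Sigma : Z -> Prop) (I : R -> Prop)
    (mu : Z -> R) (x0 : Z -> C) (m : R -> R) (x : Z -> R -> C) : Prop := {
  Darboux_polarized : is_polarization Sigma mu;
  Darboux_parameter : forall s, I s -> m s <> 0;
  Darboux_smooth : forall n, Sigma n -> smooth_on I (x n);
  Darboux_initial : exists s0, I s0 /\ forall n, Sigma n -> x n s0 = x0 n;
  Darboux_cross_ratio : forall n s, is_edge Sigma n -> I s ->
    (deriv_on I (x n) s * deriv_on I (x (n + 1)%Z) s /
       ((x n s - x (n + 1)%Z s) * (x n s - x (n + 1)%Z s)))%C
    = RtoC (mu n / m s)
}.

(* Main.v *)
Require Import Defs.
From Stdlib Require Import Reals ZArith Lra.
From Coquelicot Require Import Coquelicot.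

(** Why the theorem is true.  Fix an edge and write [T] for its unit tangent,
    [a] for its length, so that [x_(n+1) - x_n = a T].  The isoperimetric
    condition says that the velocities of the two end points are [e^(iw) T] and
    [e^(-iw) T], mirror images of each other in the line of the edge.

    - Their difference is [-2i sin w T], which is orthogonal to the edge; so
      the derivative of [a^2] vanishes ([edge_velocity_orthogonal]) and [a]
      does not depend on [s] ([edge_length_constant]).
    - Their product is [T^2], because the two rotations cancel; divided by
      [(x_n - x_(n+1))^2 = a^2 T^2] this leaves [1 / a^2]
      ([mKdV_cross_ratio]).

    Since [a] is constant, [1 / a^2] is the polarization [mu] of the initial
    curve, so the Darboux condition holds with the constant parameter function
    [m = 1], and [mu] remains the arc-length polarization at every time.

    The analytic point is that a function whose derivative relative to an
    interval is zero is constant, where at the ends of the interval the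
    derivative is one-sided.  The interval is reached from the whole line by
    the smooth map [t |-> u + (v - u) (1 - cos t) / 2], which takes values
    between [u] and [v]: after composition with it all derivatives are
    two-sided, and the mean value theorem applies between [0] and [PI]. *)

(** * Functions with zero derivative on an interval *)

(** The chain rule needs the inner function to take its values in [I], since
    the outer one is only differentiable relative to [I]. *)
Lemma is_derive_comp_on (I : R -> Prop) (f : R -> C) (phi : R -> R)
    (t dphi : R) (l : C) :
  (forall u, I (phi u)) -> is_deriv_on I f (phi t) l -> is_derive phi t dphi ->
  is_derive (V := C_R_NormedModule) (fun u => f (phi u)) t (scal dphi l).
Proof.
  intros Hphi [Hlin Hf] Hd.
  assert (Hc : filterlim phi (locally t) (locally (phi t))).
  { apply (ex_derive_continuous phi t). exists dphi. exact Hd. }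
  assert (Hle : filter_le (filtermap phi (locally t)) (within I (locally (phi t)))).
  { intros P HP. unfold filtermap. generalize (Hc _ HP). unfold filtermap.
    apply filter_imp. intros u Hu. exact (Hu (Hphi u)). }
  assert (Hg : filterdiff (U := R_NormedModule) (V := C_R_NormedModule)
                 f (filtermap phi (locally t)) (fun h => scal h l)).
  { split; [exact Hlin |]. intros y Hy.
    assert (E : phi t = y).
    { apply (is_filter_lim_unique (V := R_NormedModule)
               (F := filtermap phi (locally t))); [exact Hc | exact Hy]. }
    subst y. intros eps. apply Hle. apply (Hf (phi t)).
    intros P HP. apply filter_le_within. exact HP. }
  assert (K := filterdiff_comp (U := R_NormedModule) (V := R_NormedModule)
                 (W := C_R_NormedModule) phi f _ _ Hd Hg).
  refine (filterdiff_ext_lin _ _ _ K _).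
  intros y. symmetry. apply (scal_assoc (V := C_R_NormedModule)).
Qed.

Lemma is_derive_Re (f : R -> C) (t : R) (l : C) :
  is_derive (V := C_R_NormedModule) f t l -> is_derive (fun u => Re (f u)) t (Re l).
Proof.
  intros H.
  exact (filterdiff_comp (U := R_NormedModule) (V := C_R_NormedModule)
           (W := R_NormedModule) f (fun z => fst z) _ (fun z => fst z) H
           (filterdiff_linear _ is_linear_fst)).
Qed.

Lemma is_derive_Im (f : R -> C) (t : R) (l : C) :
  is_derive (V := C_R_NormedModule) f t l -> is_derive (fun u => Im (f u)) t (Im l).
Proof.
  intros H.
  exact (filterdiff_comp (U := R_NormedModule) (V := C_R_NormedModule)
           (W := R_NormedModule) f (fun z => snd z) _ (fun z => snd z) H
           (filterdiff_linear _ is_linear_snd)).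
Qed.

Lemma is_deriv_on_minus (I : R -> Prop) (f g : R -> C) (s : R) (l k : C) :
  is_deriv_on I f s l -> is_deriv_on I g s k ->
  is_deriv_on I (fun u => (f u - g u)%C) s (l - k)%C.
Proof.
  intros Hf Hg. unfold is_deriv_on.
  refine (filterdiff_ext_lin _ _ _ (filterdiff_minus_fct f g _ _ Hf Hg) _).
  intros y. apply injective_projections; cbn; ring.
Qed.

Lemma Cmod_sqr (z : C) : Cmod z ^ 2 = Re z ^ 2 + Im z ^ 2.
Proof.
  unfold Cmod. rewrite pow2_sqrt; [reflexivity | destruct z; cbn; nra].
Qed.

(** A planar motion whose velocity is orthogonal to its position stays on a
    circle: the derivative of the squared modulus is twice their scalar
    product.  The squared modulus is used since it is smooth also at [0]. *)
Lemma Cmod_constant_lt (I : R -> Prop) (f df : R -> C) (u v : R) :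
  is_interval I -> I u -> I v -> u < v ->
  (forall s, I s -> is_deriv_on I f s (df s)) ->
  (forall s, I s -> Re (f s) * Re (df s) + Im (f s) * Im (df s) = 0) ->
  Cmod (f u) = Cmod (f v).
Proof.
  intros [HI _] Iu Iv Huv Hf Horth.
  set (phi := fun t => u + (v - u) * (1 - cos t) / 2).
  assert (Hphi : forall t, I (phi t)).
  { intros t. apply (HI u _ v Iu Iv). unfold phi.
    assert (B := COS_bound t). nra. }
  assert (Hd : forall t, is_derive phi t ((v - u) * sin t / 2)).
  { intros t. unfold phi. auto_derive; [exact Logic.I | field]. }
  assert (E : Re (f (phi 0)) ^ 2 + Im (f (phi 0)) ^ 2
            = Re (f (phi PI)) ^ 2 + Im (f (phi PI)) ^ 2).
  { apply (eq_is_derive (V := R_NormedModule)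
             (fun t => Re (f (phi t)) ^ 2 + Im (f (phi t)) ^ 2));
      [| exact PI_RGT_0].
    intros t _.
    assert (K := is_derive_comp_on I f phi t _ _ Hphi (Hf _ (Hphi t)) (Hd t)).
    assert (K1 := is_derive_Re _ _ _ K). assert (K2 := is_derive_Im _ _ _ K).
    assert (S := is_derive_plus _ _ _ _ _
                   (is_derive_pow _ 2 _ _ K1) (is_derive_pow _ 2 _ _ K2)).
    refine (eq_ind _ (is_derive _ t) S _ _).
    assert (O := Horth _ (Hphi t)). revert O.
    generalize (df (phi t)) (f (phi t)) ((v - u) * sin t / 2).
    intros [p q] [a b] c. cbn. intros O.
    replace (_ + _) with (2 * c * (a * p + b * q)) by ring.
    rewrite O. ring. }
  (* The reparametrization runs from [u] at [0] to [v] at [PI]. *)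
  assert (E0 : phi 0 = u) by (unfold phi; rewrite cos_0; field).
  assert (E1 : phi PI = v) by (unfold phi; rewrite cos_PI; field).
  rewrite E0, E1, <- !Cmod_sqr in E.
  apply Rsqr_inj; try apply Cmod_ge_0. rewrite !Rsqr_pow2. exact E.
Qed.

Lemma Cmod_constant (I : R -> Prop) (f df : R -> C) (u v : R) :
  is_interval I -> I u -> I v ->
  (forall s, I s -> is_deriv_on I f s (df s)) ->
  (forall s, I s -> Re (f s) * Re (df s) + Im (f s) * Im (df s) = 0) ->
  Cmod (f u) = Cmod (f v).
Proof.
  intros HI Iu Iv Hf Ho.
  destruct (Rtotal_order u v) as [H | [-> | H]].
  - exact (Cmod_constant_lt I f df u v HI Iu Iv H Hf Ho).
  - reflexivity.
  - symmetry. exact (Cmod_constant_lt I f df v u HI Iv Iu H Hf Ho).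
Qed.

(** * One edge of an isoperimetric mKdV motion *)

Lemma edge_length_pos (x : Z -> C) (n : Z) :
  x n <> x (n + 1)%Z -> 0 < edge_length x n.
Proof.
  intros H. apply Cmod_gt_0. intros E. apply H.
  replace (x (n + 1)%Z) with (x (n + 1)%Z - x n + x n)%C by ring.
  rewrite E. ring.
Qed.

Lemma edge_eq_tangent (x : Z -> C) (n : Z) :
  x n <> x (n + 1)%Z ->
  (x (n + 1)%Z - x n = RtoC (edge_length x n) * edge_tangent x n)%C.
Proof.
  intros H. assert (P := edge_length_pos x n H). unfold edge_tangent.
  field. intros E. apply RtoC_inj in E. lra.
Qed.

(** Rotating [T] by [w] and by [-w] changes it by opposite multiples of [iT],
    up to a common multiple of [T]; so the difference is a multiple of [iT]. *)
Lemma edge_velocity_orthogonal (a w : R) (T : C) :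
  let d := (RtoC a * T)%C in
  let d' := (Cexpi (- w) * T - Cexpi w * T)%C in
  Re d * Re d' + Im d * Im d' = 0.
Proof.
  destruct T as [p q]. unfold Cexpi. rewrite cos_neg, sin_neg. cbn. ring.
Qed.

Lemma Cexpi_mul_opp (w : R) : (Cexpi w * Cexpi (- w))%C = 1%C.
Proof.
  unfold Cexpi. rewrite cos_neg, sin_neg.
  assert (H := sin2_cos2 w). unfold Rsqr in H.
  apply injective_projections; cbn; lra.
Qed.

Lemma mKdV_is_deriv_on (Sigma : Z -> Prop) (I : R -> Prop) (x : Z -> R -> C)
    (n : Z) (s : R) :
  is_interval I -> is_mKdV_motion Sigma I x -> Sigma n -> I s ->
  is_deriv_on I (x n) s (deriv_on I (x n) s).
Proof.
  intros HI Hx Hn Is. apply deriv_on_correct; auto.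
  exact (mKdV_smooth _ _ _ Hx n Hn 0%nat s Is).
Qed.

Lemma edge_length_constant (Sigma : Z -> Prop) (I : R -> Prop)
    (x : Z -> R -> C) (n : Z) (u v : R) :
  is_interval I -> is_mKdV_motion Sigma I x -> is_edge Sigma n -> I u -> I v ->
  edge_length (fun k => x k u) n = edge_length (fun k => x k v) n.
Proof.
  intros HI Hx He Iu Iv.
  apply (Cmod_constant I (fun s => x (n + 1)%Z s - x n s)%C
    (fun s => deriv_on I (x (n + 1)%Z) s - deriv_on I (x n) s)%C u v HI Iu Iv).
  - intros s Is. destruct He as [Hn Hn1].
    apply is_deriv_on_minus; eapply mKdV_is_deriv_on; eauto.
  - intros s Is.
    destruct (mKdV_isoperimetric _ _ _ Hx n s He Is) as (w & W0 & W1).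
    rewrite W0, W1.
    rewrite (edge_eq_tangent (fun k => x k s) n (mKdV_immersed _ _ _ Hx n s He Is)).
    apply edge_velocity_orthogonal.
Qed.

Lemma mKdV_cross_ratio (Sigma : Z -> Prop) (I : R -> Prop)
    (x : Z -> R -> C) (n : Z) (s : R) :
  is_mKdV_motion Sigma I x -> is_edge Sigma n -> I s ->
  (deriv_on I (x n) s * deriv_on I (x (n + 1)%Z) s /
     ((x n s - x (n + 1)%Z s) * (x n s - x (n + 1)%Z s)))%C
  = RtoC (1 / edge_length (fun k => x k s) n ^ 2).
Proof.
  intros Hx He Is.
  assert (Himm := mKdV_immersed _ _ _ Hx n s He Is).
  destruct (mKdV_isoperimetric _ _ _ Hx n s He Is) as (w & W0 & W1).
  assert (P := edge_length_pos (fun k => x k s) n Himm).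
  assert (E := edge_eq_tangent (fun k => x k s) n Himm). cbv beta in E.
  rewrite W0, W1. revert P E.
  generalize (edge_length (fun k => x k s) n) (edge_tangent (fun k => x k s) n).
  intros a T P E.
  assert (Ha : RtoC a <> 0%C) by (intros F; apply RtoC_inj in F; lra).
  assert (HT : T <> 0%C).
  { intros F. apply Himm. rewrite F in E.
    replace (x (n + 1)%Z s) with (x (n + 1)%Z s - x n s + x n s)%C by ring.
    rewrite E. ring. }
  replace (Cexpi w * T * (Cexpi (- w) * T))%C
    with (Cexpi w * Cexpi (- w) * (T * T))%C by ring.
  replace (x n s - x (n + 1)%Z s)%C with (- (x (n + 1)%Z s - x n s))%C by ring.
  rewrite Cexpi_mul_opp, E, RtoC_div by (apply pow_nonzero; lra).
  rewrite RtoC_pow. field. auto.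
Qed.

Theorem proposition3p3 :
  forall (Sigma : Z -> Prop) (I : R -> Prop) (x : Z -> R -> C)
         (x0 : Z -> C) (s0 : R) (mu : Z -> R),
    is_discrete_interval Sigma ->
    is_interval I ->
    is_mKdV_motion Sigma I x ->
    I s0 ->
    (forall n : Z, Sigma n -> x0 n = x n s0) ->
    (forall n : Z, is_edge Sigma n -> mu n = (1 / edge_length x0 n ^ 2)%R) ->
    (exists m : R -> R, is_infinitesimal_Darboux Sigma I mu x0 m x) /\
    (forall s : R, I s -> is_arclength_polarization Sigma mu (fun n => x n s)).
Proof.
  intros Sigma I x x0 s0 mu _ HI Hx I0 Hx0 Hmu.
  assert (Hmus : forall n s, is_edge Sigma n -> I s ->
            mu n = 1 / edge_length (fun k => x k s) n ^ 2).
  { intros n s He Is.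
    rewrite (Hmu n He), (edge_length_constant Sigma I x n s s0 HI Hx He Is I0).
    unfold edge_length. destruct He as [Hn Hn1].
    rewrite (Hx0 n Hn), (Hx0 _ Hn1). reflexivity. }
  assert (Hpos : forall n s, is_edge Sigma n -> I s ->
            0 < edge_length (fun k => x k s) n).
  { intros n s He Is. apply edge_length_pos.
    exact (mKdV_immersed _ _ _ Hx n s He Is). }
  assert (Hpol : is_polarization Sigma mu).
  { left. intros n He. rewrite (Hmus n s0 He I0).
    apply Rdiv_lt_0_compat; [lra | apply pow_lt, Hpos; auto]. }
  split.
  - exists (fun _ => 1). split.
    + exact Hpol.
    + intros s _. lra.
    + exact (mKdV_smooth _ _ _ Hx).
    + exists s0. split; [exact I0 |]. intros n Hn. symmetry. exact (Hx0 n Hn).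
    + intros n s He Is. rewrite (mKdV_cross_ratio Sigma I x n s Hx He Is).
      rewrite (Hmus n s He Is). f_equal. field.
      assert (P := Hpos n s He Is). lra.
  - intros s Is. split; [exact Hpol |]. intros n He.
    assert (P := Hpos n s He Is).
    rewrite (Hmus n s He Is). unfold edge_length in *.
    replace (x n s - x (n + 1)%Z s)%C with (- (x (n + 1)%Z s - x n s))%C by ring.
    rewrite Cmod_opp. field. lra.
Qed.
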